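(* For any directed tree $T$ of order $n\ge2$, $L^t_2(T)\le\gamma^t_{\times2}(T)$.
   Context: A directed tree is a digraph whose underlying graph is a tree. A vertex $u$ is adjacent with $v$ if $(u,v)$ or $(v,u)$ is an arc; $D\langle S\rangle$ is the subdigraph induced by $S$. A total $2$-dominating set is a set $S\subseteq V(T)$ such that $T\langle S\rangle$ has no isolated vertices and every vertex of $V(T)\setminus S$ has at least two in-neighbours in $S$; $\gamma^t_{\times2}(T)$ is its minimum size. A total $2$-limited packing is a set $B\subseteq V(T)$ such that every vertex in $B$ is adjacent with at most one vertex of $B$ and every vertex in $V(T)\setminus B$ has at most two out-neighbours in $B$; $L^t_2(T)$ is its maximum size. *)

(* Defs.v *)
From mathcomp Require Import all_boot.

Set Implicit Arguments.
Unset Strict Implicit.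
Unset Printing Implicit Defensive.

Record digraph (V : finType) := Digraph {
  arc :> rel V;
  arc_irr : irreflexive arc
}.

(* Adjacency in the digraph, i.e. the edge relation of the underlying simple
   graph; a pair of opposite arcs gives a single edge. *)
Definition adj (V : finType) (D : digraph V) : rel V :=
  [rel u v | D u v || D v u].

(* [ucycle] also accepts the traversal u, v, u of a single edge, so the cycles
   of a simple graph are the ucycles with at least three vertices. *)
Definition acyclic_graph (V : finType) (g : rel V) : Prop :=
  forall c : seq V, ucycle g c -> size c < 3.

Definition connected_graph (V : finType) (g : rel V) : Prop :=
  0 < #|V| /\ forall u v : V, connect g u v.

Definition directed_tree (V : finType) (D : digraph V) : Prop :=
  connected_graph (adj D) /\ acyclic_graph (adj D).

Definition induced (V : finType) (D : digraph V) (S : {set V}) :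
    digraph {x : V | x \in S} :=
  @Digraph {x : V | x \in S} (fun u v => D (val u) (val v))
    (fun u => arc_irr D (val u)).

Definition isolated (V : finType) (D : digraph V) (v : V) : bool :=
  [forall u, ~~ adj D v u].

Definition total_2_dominating (V : finType) (D : digraph V) (S : {set V}) :=
  [forall v, ~~ isolated (induced D S) v] &&
  [forall (v | v \notin S), 2 <= #|[set u in S | D u v]|].

Definition total_2_limited_packing (V : finType) (D : digraph V) (B : {set V}) :=
  [forall (v | v \in B), #|[set u in B | adj D v u]| <= 1] &&
  [forall (v | v \notin B), #|[set u in B | D v u]| <= 2].

(* The default [setT] of [arg min] must itself be a total 2-dominating set for
   this to be the minimum; see [total_2_dominating_setT]. *)
Definition gamma_t_x2 (V : finType) (D : digraph V) : nat :=
  #|[arg min_(S < [set: V] | total_2_dominating D S) #|S|]|.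

Definition L_t_2 (V : finType) (D : digraph V) : nat :=
  \max_(B : {set V} | total_2_limited_packing D B) #|B|.

Lemma total_2_dominating_setT (V : finType) (D : digraph V) :
  directed_tree D -> 2 <= #|V| -> total_2_dominating D [set: V].
Proof.
move=> [[_ con] _] n2; apply/andP; split; last first.
  by apply/forallP => v; rewrite inE.
apply/forallP => -[v vT]; apply/forallPn.
have [w wv] : exists w, w != v.
  apply/existsP; apply: contraLR n2 => /existsPn h.
  by rewrite -ltnNge ltnS; apply/fintype_le1P => x y; rewrite
    (eqP (negbNE (h x))) (eqP (negbNE (h y))).
case/connectP: (con v w) wv => -[|u p] /= => [_ ->|/andP[vu _] _ _].
  by rewrite eqxx.
by exists (exist _ u (in_setT u)); rewrite negbK.
Qed.

Lemma total_2_limited_packing_set0 (V : finType) (D : digraph V) :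
  total_2_limited_packing D set0.
Proof.
apply/andP; split; apply/forallP => v; rewrite inE //=.
by rewrite (_ : [set _ in _ | _] = set0) ?cards0 //; apply/setP => u; rewrite !inE.
Qed.

(* Main.v *)
Require Import Defs.
From mathcomp Require Import all_boot.

(** Let [S] be total 2-dominating and [B] a total 2-limited packing; put
    [X := B :\: S] and [Y := S :\: B], and let [Z] be the set of the vertices of
    [S :&: B] that are adjacent to [X].  A vertex of [X] has two in-neighbours
    in [S], which lie in [Y :|: Z].  A vertex of [Z] has its only [B]-neighbour
    in [X], so the neighbour in [S] that it must have lies in [Y].  Hence the
    forest induced on the disjoint union of [X], [Y] and [Z] has at least
    [2 * #|X| + #|Z|] edges and at most [#|X| + #|Y| + #|Z|], which gives
    [#|X| <= #|Y|] and so [#|B| <= #|S|]. *)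

Lemma sum_disjointU (V : finType) (A B : {set V}) (F : V -> nat) :
  [disjoint A & B] ->
  \sum_(i in A :|: B) F i = \sum_(i in A) F i + \sum_(i in B) F i.
Proof. by move=> dAB; rewrite -bigU //; apply: eq_bigl => i; rewrite !inE. Qed.

Section Forest.

Variables (V : finType) (g : rel V).
Hypotheses (g_irr : irreflexive g) (g_sym : symmetric g).
Hypothesis g_acyclic : acyclic_graph g.

(* The neighbours of the first vertex of a longest path all lie on that path,
   and one of them that is not the second vertex closes a cycle. *)
Lemma acyclic_graph_leaf (W : {set V}) :
  W != set0 -> exists2 w, w \in W & #|[set v in W | g w v]| <= 1.
Proof.
case/set0Pn=> x0 x0W; apply/exists_inP.
apply: contraT => /exists_inPn noleaf.
(* The path [x :: s] grows at its head while [n] bounds [#|V| - size s]; at [n = 0] it would have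
   more than [#|V|] distinct vertices. *)
suff no_path n x s : #|V| - size s <= n -> path g x s -> uniq (x :: s) ->
    x \in W -> False by case: (no_path #|V| x0 [::]); rewrite ?subn0.
elim: n x s => [|n IHn] x s le_n gxs xs_uniq xW.
  have := uniq_leq_size xs_uniq (fun v _ => mem_enum V v).
  by rewrite -cardE -subn_eq0 subSn -?subn_eq0 -?leqn0.
have nbr_path y : y \in W -> g x y -> y \in s.
  move=> yW gxy; apply: contraT => yNs; case: (IHn y (x :: s)) => //=.
  - by rewrite subnS -ltnS; case: (_ - _) le_n.
  - by rewrite g_sym gxy.
  rewrite inE negb_or yNs andbT; move: xs_uniq => /= -> /=; rewrite andbT.
  by apply: contraTneq gxy => ->; rewrite g_irr.
have /card_gt1P[y1 [y2 []]] : 1 < #|[set v in W | g x v]|.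
  by rewrite ltnNge noleaf.
rewrite !inE => /andP[y1W gxy1] /andP[y2W gxy2] y1y2.
have [y [gxy ys yNhd]] : exists y, [/\ g x y, y \in s & y != head x s].
  have [y1hd|y1Nhd] := eqVneq y1 (head x s).
    by exists y2; rewrite gxy2 nbr_path // -y1hd eq_sym.
  by exists y1; rewrite gxy1 nbr_path.
case/splitPr: ys gxs xs_uniq yNhd => p1 p2.
(* As [y] is not the second vertex, [p1] is nonempty and the closed path has at least three
   vertices. *)
case: p1 => [|z p1]; first by rewrite /= eqxx.
rewrite -cat_rcons -cat_cons cat_path cat_uniq -[rcons _ _]/(rcons (z :: p1) y).
move=> /andP[gxp _] /andP[xp_uniq _] _.
suff /g_acyclic : ucycle g (x :: rcons (z :: p1) y) by rewrite /= size_rcons.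
by rewrite /ucycle xp_uniq andbT /cycle rcons_path gxp last_rcons g_sym.
Qed.

(** Each edge has at most one direction in [h], so the sum counts edges of a forest, and deleting a
    leaf of [W] loses at most one of them. *)
Lemma acyclic_graph_edges (h : rel V) (W : {set V}) :
    subrel h g -> (forall u v, h u v -> ~~ h v u) ->
  \sum_(u in W) #|[set v in W | h u v]| <= #|W|.
Proof.
move=> hg h_asym; have [n] := ubnP #|W|; elim: n W => // n IHn W.
have [-> _|W0] := eqVneq W set0; first by rewrite big_set0.
have [w wW degw] := acyclic_graph_leaf W W0.
rewrite (cardsD1 w W) wW add1n ltnS => leWn.
rewrite (big_setD1 w) //=.
have -> : \sum_(u in W :\ w) #|[set v in W | h u v]| =
    \sum_(u in W :\ w) h u w + \sum_(u in W :\ w) #|[set v in W :\ w | h u v]|.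
  rewrite -big_split; apply: eq_bigr => u _ /=.
  rewrite (cardsD1 w) inE wW; congr (_ + #|pred_of_set _|).
  by apply/setP => v; rewrite !inE andbA.
rewrite addnA -[leqRHS]add1n; apply: leq_add; last exact: IHn.
apply: leq_trans degw.
have -> : \sum_(u in W :\ w) h u w = #|[set u in W :\ w | h u w]|.
  rewrite -sum1_card big_mkcond [RHS]big_mkcond /=; apply: eq_bigr => u _.
  by rewrite !inE; case: (_ && _); case: (h u w).
(* By asymmetry the out- and in-neighbours of [w] are disjoint, so together they number at most the
   degree of the leaf. *)
rewrite -cardsUI (_ : _ :&: _ = set0) ?cards0 ?addn0; last first.
  apply/setP => v; rewrite !inE; apply/negP => /andP[/andP[_ hwv] /andP[_ hvw]].
  by have := h_asym _ _ hwv; rewrite hvw.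
apply/subset_leq_card/subsetP => v; rewrite !inE.
case/orP=> [/andP[-> /hg ->] // | /andP[/andP[_ ->] /hg]].
by rewrite g_sym.
Qed.

End Forest.

Section Bound.

Variables (V : finType) (T : digraph V).

Lemma adj_irr : irreflexive (adj T).
Proof. by move=> u; rewrite /adj /= arc_irr. Qed.

Lemma adj_sym : symmetric (adj T).
Proof. by move=> u v; rewrite /adj /= orbC. Qed.

Lemma limited_packing_le_dominating (S B : {set V}) :
    acyclic_graph (adj T) -> total_2_dominating T S ->
  total_2_limited_packing T B -> #|B| <= #|S|.
Proof.
move=> acT /andP[/forallP S_tot /forallP S_dom] /andP[/forallP B_lim _].
pose X := B :\: S; pose Y := S :\: B.
pose Z := [set z in S :&: B | [exists x in X, adj T z x]].
have S_nbr z : z \in S -> exists2 y, y \in S & adj T z y.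
  move=> zS; have /forallPn[[y yS]] := S_tot (exist _ z zS).
  by rewrite negbK => zy; exists y.
have B_nbr u v w : u \in B -> v \in B -> w \in B -> adj T u v -> adj T u w ->
    v = w.
  move=> uB vB wB uv uw; have := B_lim u; rewrite uB => /card_le1_eqP.
  by apply; rewrite inE ?vB ?wB.
(* Orienting edges from [X] to [Y :|: Z] and from [Z] to [Y] counts each once, whatever its
   direction in [T]. *)
pose h := [rel u v | adj T u v &&
  ((u \in X) && (v \in Y :|: Z) || (u \in Z) && (v \in Y))].
pose W := X :|: (Z :|: Y).
have hle : \sum_(u in W) #|[set v in W | h u v]| <= #|W|.
  apply: (acyclic_graph_edges _ _ adj_irr adj_sym acT) => [u v /andP[]//|u v].
  rewrite /= !inE; case: (u \in S); case: (u \in B); case: (v \in S);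
  by case: (v \in B); rewrite /= ?andbF ?orbF.
have dZY : [disjoint Z & Y].
  by rewrite -setI_eq0; apply/eqP/setP => v; rewrite !inE;
     case: (v \in S); case: (v \in B); rewrite ?andbF.
have dXW : [disjoint X & Z :|: Y].
  by rewrite -setI_eq0; apply/eqP/setP => v; rewrite !inE;
     case: (v \in S); case: (v \in B); rewrite ?andbF.
have cardW : #|W| = #|X| + (#|Z| + #|Y|).
  by rewrite !cardsU (disjoint_setI0 dXW) (disjoint_setI0 dZY) cards0 !subn0.
have degX : #|X| * 2 <= \sum_(u in X) #|[set v in W | h u v]|.
  rewrite -sum_nat_const; apply: leq_sum => x xX.
  have /[!inE]/andP[xNS xB] := xX.
  have := S_dom x; rewrite xNS => /leq_trans; apply.
  apply/subset_leq_card/subsetP => v /setIdP[vS vx].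
  have xv : adj T x v by rewrite /adj /= vx orbT.
  have vYZ : v \in Y :|: Z.
    rewrite 3!inE vS andbT !inE vS /=; case: (v \in B) => //=.
    by apply/existsP; exists x; rewrite xX adj_sym.
  by rewrite inE /h /= xv xX vYZ !andbT inE setUC vYZ orbT.
have degZ : #|Z| <= \sum_(u in Z) #|[set v in W | h u v]|.
  rewrite -sum1_card; apply: leq_sum => z zZ; apply/card_gt0P.
  have /[!inE]/andP[/andP[zS zB] /existsP[x]] := zZ.
  rewrite !inE => /andP[/andP[xNS xB] zx].
  have [y yS zy] := S_nbr z zS; exists y.
  have yNB : y \notin B.
    (* Otherwise [x] and [y] would be two [B]-neighbours of [z], hence equal, which puts [x] in
       [S]. *)
    by apply: contra xNS => yB; rewrite (B_nbr z x y).
  have yY : y \in Y by rewrite inE yS yNB.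
  by rewrite inE /h /= zy zZ yY inE [y \in _ :|: Y]inE yY !orbT.
have XY : #|X| <= #|Y|.
  (* Adding [#|X| + #|Z|] makes the right side [#|W|]; the part of the degree sum over [Y] is then
     dropped. *)
  rewrite -(leq_add2l (#|X| + #|Z|)) -[leqRHS]addnA -cardW.
  apply: leq_trans hle; rewrite sum_disjointU // sum_disjointU //.
  rewrite addnAC addnn -muln2 addnA; apply: leq_trans (leq_addr _ _).
  exact: leq_add.
by rewrite -(cardsID S B) -(cardsID B S) setIC leq_add2l.
Qed.

End Bound.

Theorem theorem4 (V : finType) (T : digraph V) (hT : directed_tree T)
  (hn : 2 <= #|V|) : L_t_2 T <= gamma_t_x2 T.
Proof.
have [_ acT] := hT; apply/bigmax_leqP => B packB; rewrite /gamma_t_x2.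
(* [hn] enters here: on a single vertex the default [[set: V]] would induce an isolated vertex. *)
case: arg_minnP => [|S domS _]; first exact: total_2_dominating_setT.
exact: (limited_packing_le_dominating _ T).
Qed.
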